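(* Let $0<\lambda<1$, $\beta>0$, $\sigma\ge 0$, $\alpha\ge0$ and $p\in\{1,2,\infty\}$. Let $\nu$ be a probability distribution supported on $[0,1]$ with $\nu(\{0\})=0$, and let $\nu_{noise}$ be a probability distribution supported on a bounded interval of $\mathbb{R}_+$ with mean $1$. For each $N\ge d$ sample independently $\ell_1,\dots,\ell_d\sim\nu$, $s_1,\dots,s_d\sim\nu_{noise}$, and $X_1,X_2$ uniformly from the Stiefel manifold of $N\times d$ matrices with $X_i^TX_i=I_d$, and set $$X_{tr}=X_1\,\mathrm{diag}(\sqrt{\ell_i}),\qquad X_{test}=X_2\,\mathrm{diag}(\sqrt{\ell_is_i}).$$ Let $\beta_0\in\mathbb{R}^d$ be deterministic and let $Y_{tr}=X_{tr}\beta_0+\epsilon$, where $\epsilon\in\mathbb{R}^N$ has i.i.d. entries of mean zero and variance $\sigma^2$, independent of everything else. Let $\hat\beta$ be the $p$-bias constrained estimator with regularization strength $\alpha$ computed from $(X_{tr},Y_{tr})$, and let $$MSE=N^{-1}|X_{test}\hat\beta-X_{test}\beta_0|^2.$$ Then in the limit $N,d\to\infty$ with $d/N\to\lambda$ and $|\beta_0|^2/d\to\beta^2$, the average test error $\mathbb{E}\,MSE$ (expectation over $X_{tr},X_{test},\epsilon,s$) converges to $$Err_p(\alpha)=\lambda\int_0^1\left[\beta^2x\left(1-\frac{x}{f_\alpha(x)}\right)^2+\sigma^2\frac{x^2}{f_\alpha(x)^2}\right]\nu(dx),$$ where $f_\alpha(x)=\max(x,\alpha)$ if $p=1$, $f_\alpha(x)=x+\alpha$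 if $p=2$, and $f_\alpha(x)=x(1+\alpha)$ if $p=\infty$.
   Context: For $X\in\mathbb{R}^{N\times d}$ with $G=X^TX$ invertible and $G=U\,\mathrm{diag}(\sigma_1,\dots,\sigma_d)U^T$ an orthogonal diagonalization, the $p$-bias constrained estimator computed from $(X,Y)$ with regularization strength $\alpha$ is $\hat\beta=\hat G^{-1}X^TY$, where $\hat G=U\,\mathrm{diag}(\max(\sigma_i,\alpha))U^T$ for $p=1$ (nuclear), $\hat G=G+\alpha I_d$ for $p=2$ (ridge), and $\hat G=(1+\alpha)G$ for $p=\infty$ (spectral). Here it is applied with $X=X_{tr}$, $Y=Y_{tr}$. *)

(* Defs.v *)
From HB Require Import structures.
From mathcomp Require Import all_boot all_order all_algebra.
From mathcomp Require Import all_classical all_reals all_analysis.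
Set Implicit Arguments.
Unset Strict Implicit.
Unset Printing Implicit Defensive.
Import Order.TTheory GRing.Theory Num.Theory.
Import numFieldNormedType.Exports.
Local Open Scope classical_set_scope.
Local Open Scope ring_scope.

Notation borel_mx R m n := (g_sigma_algebraType (@open 'M[R]_(m, n))).

Definition sqnorm (R : realType) (m : nat) (v : 'cV[R]_m) : R :=
  \sum_(i < m) v i 0 ^+ 2.

(** The exponents p = 1, 2, oo, respectively. *)
Inductive bias := Nuclear | Ridge | Spectral.

Definition orthogonal_diagonalization (R : realType) (d : nat)
    (G U : 'M[R]_d) (ev : 'rV[R]_d) : Prop :=
  U^T *m U = 1%:M /\ G = U *m diag_mx ev *m U^T.

Definition biased_gram (R : realType) (d : nat) (p : bias) (alpha : R)
    (G U : 'M[R]_d) (ev : 'rV[R]_d) : 'M[R]_d :=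
  match p with
  | Nuclear => U *m diag_mx (\row_i Num.max (ev 0 i) alpha) *m U^T
  | Ridge => G + alpha%:M
  | Spectral => (1 + alpha) *: G
  end.

(** [U], [ev] are meant to be an orthogonal diagonalization of [X^T *m X].  The
    estimator is defined when [X^T *m X] is invertible; [invmx] is total, so it
    takes an arbitrary value otherwise. *)
Definition biased_estimator (R : realType) (N d : nat) (p : bias) (alpha : R)
    (X : 'M[R]_(N, d)) (Y : 'cV[R]_N) (U : 'M[R]_d) (ev : 'rV[R]_d) :
    'cV[R]_d :=
  invmx (biased_gram p alpha (X^T *m X) U ev) *m X^T *m Y.

Definition shrinkage (R : realType) (p : bias) (alpha x : R) : R :=
  match p with
  | Nuclear => Num.max x alpha
  | Ridge => x + alpha
  | Spectral => x * (1 + alpha)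
  end.

Definition limit_err (R : realType) (nu : probability R R) (p : bias)
    (lambda beta sigma alpha : R) : \bar R :=
  (lambda%:E * \int[nu]_(x in `[0%R, 1%R])
    (beta ^+ 2 * x * (1 - x / shrinkage p alpha x) ^+ 2 +
     sigma ^+ 2 * (x ^+ 2 / shrinkage p alpha x ^+ 2))%:E)%E.

Definition mutually_independent (disp : measure_display)
    (T : measurableType disp) (R : realType) (P : probability T R)
    (I : finType) (F : I -> set_system T) : Prop :=
  forall (J : {set I}) (A : I -> set T),
    (forall i, i \in J -> F i (A i)) ->
    P (\bigcap_(i in [set` J]) A i) = (\prod_(i in J) P (A i))%E.

(** The uniform distribution on the Stiefel manifold is the unique Borel
    probability measure on it that is invariant under the (transitive) action
    of the orthogonal group O(N) by left multiplication. *)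
Definition uniform_on_stiefel (disp : measure_display)
    (T : measurableType disp) (R : realType) (P : probability T R)
    (N d : nat) (X : {RV P >-> borel_mx R N d}) : Prop :=
  (forall w, (X w : 'M[R]_(N, d))^T *m X w = 1%:M) /\
  (forall Q : 'M[R]_N, Q^T *m Q = 1%:M ->
   forall B : set (borel_mx R N d), measurable B ->
     distribution P X ([set M : 'M[R]_(N, d) | B (Q *m M)]) =
     distribution P X B).

Record sample (disp : measure_display) (T : measurableType disp)
    (R : realType) (P : probability T R) (N d : nat) := Sample {
  ell : 'I_d -> {RV P >-> R};
  scl : 'I_d -> {RV P >-> R};
  frame1 : {RV P >-> borel_mx R N d};
  frame2 : {RV P >-> borel_mx R N d};
  eps : 'I_N -> {RV P >-> R} }.

Section Sample.
Context (disp : measure_display) (T : measurableType disp) (R : realType)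
  (P : probability T R) (N d : nat) (D : sample P N d).

Definition X_tr (w : T) : 'M[R]_(N, d) :=
  (frame1 D w : 'M[R]_(N, d)) *m diag_mx (\row_i Num.sqrt (ell D i w)).

Definition X_test (w : T) : 'M[R]_(N, d) :=
  (frame2 D w : 'M[R]_(N, d)) *m
  diag_mx (\row_i Num.sqrt (ell D i w * scl D i w)).

Definition Y_tr (beta0 : 'cV[R]_d) (w : T) : 'cV[R]_N :=
  X_tr w *m beta0 + \col_i eps D i w.

Definition MSE (beta0 : 'cV[R]_d) (betahat : T -> 'cV[R]_d) (w : T) : R :=
  N%:R^-1 * sqnorm (X_test w *m betahat w - X_test w *m beta0).

Definition sample_sigma_algebra (i : 'I_d + 'I_d + (unit + unit) + 'I_N) :
    set_system T :=
  match i with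
  | inl (inl (inl i)) => g_sigma_algebra_preimage (ell D i)
  | inl (inl (inr i)) => g_sigma_algebra_preimage (scl D i)
  | inl (inr (inl _)) => g_sigma_algebra_preimage (frame1 D)
  | inl (inr (inr _)) => g_sigma_algebra_preimage (frame2 D)
  | inr i => g_sigma_algebra_preimage (eps D i)
  end.

Record sampled_from (nu nu_noise : probability R R) (sigma : R) : Prop := {
  ell_law : forall i (A : set R), measurable A ->
    distribution P (ell D i) A = nu A;
  scl_law : forall i (A : set R), measurable A ->
    distribution P (scl D i) A = nu_noise A;
  frame1_law : uniform_on_stiefel (frame1 D);
  frame2_law : uniform_on_stiefel (frame2 D);
  eps_id : forall i j (A : set R), measurable A ->
    distribution P (eps D i) A = distribution P (eps D j) A;
  eps_L2 : forall i, (eps D i : T -> R) \in Lfun P 2%:E;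
  eps_mean : forall i, 'E_P[eps D i]%E = 0%E;
  eps_var : forall i, 'V_P[eps D i]%E = (sigma ^+ 2)%:E;
  all_indep : mutually_independent P sample_sigma_algebra }.

End Sample.

(* Main.v *)
(** On the event that all [ell] are positive, which has probability 1, the
    Gram matrix of [X_tr] is [diag ell], so the regularized Gram matrix is
    [diag (f ell)] by functional calculus, whatever diagonalization is used.
    With [r = ell / f ell] and [y = X1^T eps], the MSE is therefore
      [N^-1 sum_i s_i (sqrt ell_i (r_i - 1) beta0_i + r_i y_i)^2].
    Expanding the square and using independence, the noise scales contribute
    their mean 1, the cross terms vanish because [eps] is centred, and
    [E y_i^2 = sigma^2] because the columns of [X1] are unit vectors.  Hence the
    expectation is for every [n] the explicit value
      [d/N (|beta0|^2/d E[ell (1 - r)^2] + sigma^2 E[r^2])],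
    and the limit is immediate. *)
Require Import Defs.
From mathcomp Require Import all_boot all_order all_algebra.
From mathcomp Require Import all_classical all_reals all_analysis.
From mathcomp Require Import finmap measurable_realfun ring.
Set Implicit Arguments.
Unset Strict Implicit.
Unset Printing Implicit Defensive.
Import Order.TTheory GRing.Theory Num.Theory.
Import numFieldNormedType.Exports.
Local Open Scope classical_set_scope.
Local Open Scope ring_scope.

(** * Integrals of nonnegative functions: almost sure comparison and factorization *)

Section Integrals.
Local Open Scope ereal_scope.
Import HBNNSimple.

(* No measurability is assumed: it is not available for the MSE, which is built
   from an arbitrary choice of diagonalizations. *)
Lemma ge0_le_integral_ae d (T : measurableType d) (R : realType)
    (mu : {measure set T -> \bar R}) (N : set T) (f g : T -> \bar R) :
  measurable N -> mu N = 0 -> (forall x, 0 <= f x) -> (forall x, 0 <= g x) ->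
  (forall x, ~ N x -> f x <= g x) -> \int[mu]_x f x <= \int[mu]_x g x.
Proof.
move=> mN N0 f0 g0 fg; rewrite !ge0_integralTE//.
apply: ge_ereal_sup => _ [h /= hf <-].
have mNC : measurable (~` N) by exact: measurableC.
(* The integral of a nonnegative function is the supremum over the simple functions below it.
   Setting such an [h] to 0 on the null set [N] keeps its integral and puts it below [g]
   everywhere. *)
pose h' : {nnsfun T >-> R} := proj_nnsfun h mNC.
have -> : sintegral mu h = sintegral mu h'.
  rewrite -!integralT_nnsfun; apply: ge0_ae_eq_integral => //.
  - by apply/measurable_EFinP.
  - by apply/measurable_EFinP.
  - by move=> x _; rewrite lee_fin.
  - by move=> x _; rewrite lee_fin.
  exists N; split => // x /=; apply: contra_notP => nNx _.
  by rewrite mindicE mem_set ?mulr1.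
apply: ereal_sup_ubound; exists h' => //= x; rewrite mindicE.
have [/set_mem/= nNx|_] := boolP (x \in ~` N).
  by rewrite mulr1 (le_trans (hf x))// fg.
by rewrite mulr0.
Qed.

Lemma ge0_eq_integral_ae d (T : measurableType d) (R : realType)
    (mu : {measure set T -> \bar R}) (N : set T) (f g : T -> \bar R) :
  measurable N -> mu N = 0 -> (forall x, 0 <= f x) -> (forall x, 0 <= g x) ->
  (forall x, ~ N x -> f x = g x) -> \int[mu]_x f x = \int[mu]_x g x.
Proof.
move=> mN N0 f0 g0 fg; apply/eqP; rewrite eq_le; apply/andP; split;
  by apply: (ge0_le_integral_ae mN) => // x /fg ->.
Qed.

(** Independence of [f] and [h] enters only through indicators of events of [f], which is what an
    induction over several factors can supply. Linearity extends it to simple functions of [f],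
    monotone convergence to [f] itself. *)
Lemma ge0_integral_mul_indep d (T : measurableType d) (R : realType)
    (P : probability T R) (f h : T -> R) :
  measurable_fun setT f -> (forall x, 0 <= f x)%R ->
  measurable_fun setT h -> (forall x, 0 <= h x)%R ->
  \int[P]_x (h x)%:E < +oo ->
  (forall B, measurable B -> \int[P]_x (\1_(f @^-1` B) x * h x)%:E =
     P (f @^-1` B) * \int[P]_x (h x)%:E) ->
  \int[P]_x (f x * h x)%:E = \int[P]_x (f x)%:E * \int[P]_x (h x)%:E.
Proof.
move=> mf f0 mh h0 hoo ind.
set c := \int[P]_x (h x)%:E in hoo ind *.
have c0 : 0 <= c by apply: integral_ge0 => x _; rewrite lee_fin.
have cfin : c \is a fin_num by rewrite ge0_fin_numE.
(* The approximation is done on the real line, for a nonnegative function that is the identity on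
   the values of [f]. The approximants are then [g n \o f], and their level sets are preimages under
   [f], as [ind] demands. *)
pose phi (y : R) : \bar R := (Num.max y 0%R)%:E.
have mphi : measurable_fun setT phi.
  by apply/measurable_EFinP; exact: measurable_maxr.
have phi0 y : 0 <= phi y by rewrite lee_fin le_max lexx orbT.
have phif x : phi (f x) = (f x)%:E by rewrite /phi; congr EFin; apply/max_idPl.
pose g := nnsfun_approx measurableT mphi.
have cvg_g y : (g n y)%:E @[n --> \oo] --> phi y.
  by apply: (cvg_nnsfun_approx measurableT mphi).
have nd_g y m n : (m <= n)%N -> (g m y <= g n y)%R.
  by move=> mn; apply/lefP: y; exact: nd_nnsfun_approx.
have mgf n : measurable_fun setT (g n \o f) by exact: measurableT_comp.
have mfB B : measurable B -> measurable (f @^-1` B).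
  by move=> mB; rewrite -[_ @^-1` _]setTI; exact: mf.
have H n : \int[P]_x (g n (f x) * h x)%:E = \int[P]_x (g n (f x))%:E * c.
  have E y : g n y = (\sum_(v <- fset_set (range (g n)))
      v * \1_(g n @^-1` [set v]) y)%R by rewrite [LHS]fimfunE fsbig_finite.
  have mB v : measurable (f @^-1` (g n @^-1` [set v])) by exact: mfB.
  (* Applied to [k = h] and to [k = 1]; the two resulting sums over level sets differ exactly by the
     factor [c]. *)
  have lin (k : T -> R) : measurable_fun setT k -> (forall x, 0 <= k x)%R ->
      (forall B, measurable B -> \int[P]_x (\1_(f @^-1` B) x * k x)%:E =
        P (f @^-1` B) * \int[P]_x (k x)%:E) ->
      \int[P]_x (g n (f x) * k x)%:E = \sum_(v <- fset_set (range (g n)))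
      v%:E * (P (f @^-1` (g n @^-1` [set v])) * \int[P]_x (k x)%:E).
    move=> mk k0 kind.
    under eq_integral do rewrite E mulr_suml -sumEFin.
    rewrite ge0_integral_sum//; last 2 first.
    - move=> v; apply/measurable_EFinP; apply: measurable_funM => //.
      apply: measurable_funM => //.
      by apply: measurableT_comp => //; exact: measurable_indic.
    - move=> v x _; rewrite EFinM mule_ge0 ?[0 <= (k x)%:E]lee_fin//.
      by rewrite EFinM nnfun_muleindic_ge0.
    apply: eq_bigr => v _.
    have [v0|v0] := leP 0%R v.
      rewrite -kind// -ge0_integralZl//; last 2 first.
      - by apply/measurable_EFinP; exact: measurable_funM.
      - by move=> x _; rewrite lee_fin mulr_ge0.
      by apply: eq_integral => x _; rewrite -EFinM mulrA.
    (* A negative value has an empty level set, so both sides are 0. *)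
    rewrite preimage_nnfun0// preimage_set0 measure0 mul0e mule0.
    by under eq_integral do rewrite indic0 mulr0 mul0r; rewrite integral0.
  rewrite lin// -/c.
  have int1 : \int[P]_x (cst 1%R x)%:E = 1.
    by rewrite (@integral_cst _ _ _ P _ measurableT 1)/= probability_setT mule1.
  have -> : \int[P]_x (g n (f x))%:E = \int[P]_x (g n (f x) * cst 1 x)%:E.
    by apply: eq_integral => x _; rewrite mulr1.
  rewrite lin ?int1//; last first.
    move=> B mB'; under eq_integral do rewrite mulr1.
    by rewrite integral_indic ?setIT ?mule1//; exact: mfB.
  rewrite ge0_sume_distrl; last first.
    move=> v _; rewrite mule1.
    apply: (mulemu_ge0 (fun v => f @^-1` (g n @^-1` [set v]))) => v0.
    by rewrite preimage_nnfun0// preimage_set0.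
  by apply: eq_bigr => v _; rewrite mule1 muleA.
have cvg1 : \int[P]_x (g n (f x) * h x)%:E @[n --> \oo] -->
    \int[P]_x (f x * h x)%:E.
  rewrite (_ : \int[P]_x (f x * h x)%:E =
    \int[P]_x limn (fun n => (g n (f x) * h x)%:E)).
    apply: cvg_monotone_convergence => //.
    - move=> n; apply/measurable_EFinP; apply: measurable_funM => //.
      exact: mgf.
    - by move=> n x _; rewrite lee_fin mulr_ge0.
    - by move=> x _ m n mn; rewrite lee_fin ler_wpM2r// nd_g.
  apply: eq_integral => x _; apply/esym/cvg_lim => //.
  under eq_fun do rewrite EFinM.
  by rewrite EFinM; apply: cvgeZr => //; rewrite -phif.
have cvg2 : \int[P]_x (g n (f x))%:E @[n --> \oo] --> \int[P]_x (f x)%:E.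
  rewrite (_ : \int[P]_x (f x)%:E = \int[P]_x limn (fun n => (g n (f x))%:E)).
    apply: cvg_monotone_convergence => //.
    - by move=> n; apply/measurable_EFinP; exact: mgf.
    - by move=> n x _; rewrite lee_fin.
    - by move=> x _ m n mn; rewrite lee_fin nd_g.
  by apply: eq_integral => x _; apply/esym/cvg_lim => //; rewrite -phif.
have cvg3 : \int[P]_x (g n (f x) * h x)%:E @[n --> \oo] -->
    \int[P]_x (f x)%:E * c by rewrite (funext H); exact: cvgeZr.
exact: cvg_unique cvg1 cvg3.
Qed.

End Integrals.

(** * Expectation of a product of independent factors *)

Section IndependentProducts.
Local Open Scope ereal_scope.
Context d (T : measurableType d) (R : realType) (P : probability T R).
Context (I : finType) (F : I -> set_system T).
Hypothesis F_measurable : forall i, F i `<=` measurable.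
Hypothesis F_indep : mutually_independent P F.

Definition adapted (s : seq I) (f : I -> T -> R) :=
  forall i, i \in s -> forall B, measurable B -> F i (f i @^-1` B).

Lemma adapted_measurable s f i : adapted s f -> i \in s ->
  measurable_fun setT (f i).
Proof.
move=> sf si _ B mB; rewrite setTI; apply: (@F_measurable i); exact: sf.
Qed.

Lemma measurable_prod_adapted s f : adapted s f ->
  measurable_fun setT (fun x => \prod_(i <- s) f i x)%R.
Proof.
move=> sf; apply: measurable_prod => i si; exact: adapted_measurable sf si.
Qed.

(** Independence is given for events only. The indicator of an intersection of events from the
    indices in [J], disjoint from [s], strengthens the induction: peeling off the factor [f i] calls
    for the induction hypothesis with an event of [f i] added to the intersection. *)
Lemma ge0_integral_indic_prod_indep (s : seq I) (f : I -> T -> R) :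
  uniq s -> adapted s f ->
  (forall i, i \in s -> forall x, 0 <= f i x)%R ->
  (forall i, i \in s -> \int[P]_x (f i x)%:E < +oo) ->
  forall (J : {set I}) (A : I -> set T), (forall i, i \in s -> i \notin J) ->
  (forall i, i \in J -> F i (A i)) ->
  \int[P]_x (\1_(\bigcap_(i in [set` J]) A i) x * \prod_(i <- s) f i x)%:E =
  P (\bigcap_(i in [set` J]) A i) * \prod_(i <- s) \int[P]_x (f i x)%:E.
Proof.
elim: s => [|i s IH] us sf f0 foo J A sJ FA.
  rewrite big_nil mule1.
  under eq_integral do rewrite big_nil mulr1.
  rewrite integral_indic ?setIT//.
  by apply: fin_bigcap_measurable => // j jJ; exact/F_measurable/FA.
move: us => /= /andP[nis us].
have si : i \in i :: s by rewrite mem_head.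
have sS j : j \in s -> j \in i :: s by rewrite inE orbC => ->.
have {}IH := IH us (fun j js => sf j (sS j js)) (fun j js => f0 j (sS j js))
  (fun j js => foo j (sS j js)).
set E := \bigcap_(i in [set` J]) A i.
have mE : measurable E.
  by apply: fin_bigcap_measurable => // j jJ; exact/F_measurable/FA.
pose h x := (\1_E x * \prod_(i <- s) f i x)%R.
have h0 x : (0 <= h x)%R.
  by rewrite mulr_ge0 // big_seq prodr_ge0// => j /sS js; exact: f0.
have mh : measurable_fun setT h.
  apply: measurable_funM; first exact: measurable_indic.
  by apply: measurable_prod_adapted => j /sS js; exact: sf.
have hE : \int[P]_x (h x)%:E = P E * \prod_(i <- s) \int[P]_x (f i x)%:E.
  by apply: IH => // j /sS; exact: sJ.
have c0 : 0 <= \prod_(i <- s) \int[P]_x (f i x)%:E.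
  rewrite big_seq; apply: prode_ge0 => j /sS js; apply: integral_ge0 => x _.
  by rewrite lee_fin f0.
have hoo : \int[P]_x (h x)%:E < +oo.
  rewrite hE ltey_eq fin_numM ?fin_num_measure//.
  rewrite big_seq; apply: prode_fin_num => j /sS js.
  by rewrite ge0_fin_numE ?foo// integral_ge0// => x _; rewrite lee_fin f0.
transitivity (\int[P]_x (f i x * h x)%:E).
  by apply: eq_integral => x _; rewrite big_cons mulrCA.
rewrite ge0_integral_mul_indep//; last 3 first.
- exact: adapted_measurable sf si.
- exact: f0.
- move=> B mB; set C := f i @^-1` B.
  have FC : F i C by exact: sf.
  (* Since [i] is not in [J], the family [A'] adds the event [C] at [i] and agrees with [A] on
     [J]. *)
  pose A' j := if j == i then C else A j.
  have iJ : i \notin J by exact: sJ.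
  have A'J j : j \in J -> A' j = A j.
    by move=> jJ; rewrite /A'; case: eqP => // ji; move: iJ; rewrite -ji jJ.
  have FA' j : j \in (i |: J)%SET -> F j (A' j).
    rewrite in_setU1 /A' => /orP[/eqP ->|jJ]; first by rewrite eqxx.
    by have := A'J j jJ; rewrite /A' => ->; exact: FA.
  have EA : \bigcap_(j in [set` (i |: J)%SET]) A' j = C `&` E.
    apply/seteqP; split => x.
    - move=> /= Hx; split.
        by have := Hx i; rewrite /= in_setU1 eqxx /A' eqxx; exact.
      by move=> j /= jJ; rewrite -A'J//; apply: Hx; rewrite /= in_setU1 jJ orbT.
    - move=> [Cx Ex] j /=; rewrite in_setU1 => /orP[/eqP ->|jJ].
        by rewrite /A' eqxx.
      by rewrite A'J//; exact: Ex.
  transitivity (\int[P]_x (\1_(\bigcap_(j in [set` (i |: J)%SET]) A' j) x *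
      \prod_(i <- s) f i x)%:E).
    by apply: eq_integral => x _; rewrite EA indicI mulrA.
  rewrite IH//; last first.
    move=> j js; rewrite in_setU1 negb_or sJ ?sS// andbT.
    by apply: contraNneq nis => <-.
  (* Independence is used for [i |: J] here and for [J] just below, which together give P(C and E) =
     P(C) P(E). *)
  rewrite F_indep// big_setU1//= {1}/A' eqxx -muleA; congr (_ * _).
  rewrite hE F_indep//; congr (_ * _).
  by apply: eq_bigr => j jJ; rewrite A'J.
by rewrite hE big_cons muleCA.
Qed.

Lemma ge0_integral_prod_indep (s : seq I) (f : I -> T -> R) :
  uniq s -> adapted s f ->
  (forall i, i \in s -> forall x, 0 <= f i x)%R ->
  (forall i, i \in s -> \int[P]_x (f i x)%:E < +oo) ->
  \int[P]_x (\prod_(i <- s) f i x)%:E = \prod_(i <- s) \int[P]_x (f i x)%:E.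
Proof.
move=> us sf f0 foo.
have := @ge0_integral_indic_prod_indep s f us sf f0 foo (@finset.set0 I)
  (fun=> setT).
have -> : \bigcap_(i in [set` (@finset.set0 I)]) (setT : set T) = setT.
  by apply/seteqP; split => // x _ j.
rewrite probability_setT mul1e => <-.
- by apply: eq_integral => x _; rewrite indicT mul1r.
- by move=> i _; rewrite finset.in_set0.
- by move=> i; rewrite finset.in_set0.
Qed.

(** The nonnegative case applied to the absolute values, which are adapted too, bounds the integral
    of the absolute value of the product. *)
Lemma integrable_prod_indep (s : seq I) (f : I -> T -> R) :
  uniq s -> adapted s f ->
  (forall i, i \in s -> P.-integrable setT (EFin \o f i)) ->
  P.-integrable setT (fun x => (\prod_(i <- s) f i x)%:E).
Proof.
move=> us sf fi; apply/integrableP; split.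
  by apply/measurable_EFinP; exact: measurable_prod_adapted.
have norm_lty i : i \in s -> \int[P]_x `|f i x|%:E < +oo.
  by move=> /fi /integrableP[].
under eq_integral do rewrite /= normr_prod.
rewrite (@ge0_integral_prod_indep s (fun i x => `|f i x|%R))//.
- rewrite ltey_eq big_seq prode_fin_num// => i si.
  by rewrite ge0_fin_numE ?norm_lty// integral_ge0.
- move=> i si B mB.
  have -> : (fun x => `|f i x|%R) @^-1` B = f i @^-1` (Num.norm @^-1` B) by [].
  apply: sf => //; rewrite -[_ @^-1` _]setTI; exact: normr_measurable.
Qed.

Lemma integral_prod_indep (s : seq I) (f : I -> T -> R) :
  uniq s -> adapted s f ->
  (forall i, i \in s -> P.-integrable setT (EFin \o f i)) ->
  \int[P]_x (\prod_(i <- s) f i x)%:E = \prod_(i <- s) \int[P]_x (f i x)%:E.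
Proof.
(* Signed factors are treated one at a time: those in [s1] are already nonnegative, those in [s2]
   still have arbitrary sign. With [s2] empty this is the nonnegative case. *)
suff H s1 s2 g : uniq (s1 ++ s2) -> adapted (s1 ++ s2) g ->
    (forall i, i \in s1 ++ s2 -> P.-integrable setT (EFin \o g i)) ->
    (forall i, i \in s1 -> forall x, 0 <= g i x)%R ->
    \int[P]_x (\prod_(i <- s1 ++ s2) g i x)%:E =
    \prod_(i <- s1 ++ s2) \int[P]_x (g i x)%:E.
  by move=> us sf fi; exact: (H [::] s).
elim: s2 s1 g => [|i s2 IH] s1 g us sf fi f0.
  rewrite cats0 in us sf fi *; apply: ge0_integral_prod_indep => // i si.
  have /integrableP[_] := fi i si; under eq_integral do rewrite /= ger0_norm ?f0//.
  by [].
have pm : perm_eq (s1 ++ i :: s2) (i :: s1 ++ s2).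
  by have /permPl := perm_catCA s1 [:: i] s2.
have {}us : uniq (i :: s1 ++ s2) by rewrite -(perm_uniq pm).
have {}sf : adapted (i :: s1 ++ s2) g by move=> j; rewrite -(perm_mem pm); exact: sf.
have {}fi j : j \in i :: s1 ++ s2 -> P.-integrable setT (EFin \o g j).
  by rewrite -(perm_mem pm); exact: fi.
under eq_integral do rewrite (perm_big _ pm).
rewrite (perm_big _ pm) /=.
(* [k] will be the positive part [kp] and the negative part [kn]. Both are measurable and dominated
   by the absolute value, so the modified family stays adapted and integrable. *)
pose g' (k : R -> R) j x := if j == i then k (g i x) else g j x.
have g'E k j : j \in s1 ++ s2 -> g' k j = g j.
  move=> js; apply/funext => x; rewrite /g'; case: eqP => // ji; move: us.
  by rewrite /= -ji js.
have g'i k : g' k i = k \o g i by apply/funext => x; rewrite /g' eqxx.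
have ii : i \in i :: s1 ++ s2 by rewrite mem_head.
have sS j : j \in s1 ++ s2 -> j \in i :: s1 ++ s2 by rewrite inE orbC => ->.
have g'ad (k : R -> R) : measurable_fun setT k -> adapted (i :: s1 ++ s2) (g' k).
  move=> mk j; rewrite inE => /orP[/eqP ->|js] B mB.
    rewrite g'i comp_preimage; apply: sf => //.
    by rewrite -[_ @^-1` _]setTI; exact: mk.
  by rewrite g'E//; apply: sf => //; exact: sS.
have g'int (k : R -> R) : measurable_fun setT k -> (forall y, `|k y| <= `|y|)%R ->
    forall j, j \in i :: s1 ++ s2 -> P.-integrable setT (EFin \o g' k j).
  move=> mk kle j; rewrite inE => /orP[/eqP ->|js]; last first.
    by rewrite g'E//; apply: fi; exact: sS.
  apply: (le_integrable measurableT _ _ (fi i ii)).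
    by apply/measurable_EFinP; rewrite g'i; apply: measurableT_comp => //;
      exact: adapted_measurable sf ii.
  by move=> x _; rewrite g'i /= lee_fin; exact: kle.
have key (k : R -> R) : measurable_fun setT k -> (forall y, `|k y| <= `|y|)%R ->
    (forall y, 0 <= k y)%R ->
    P.-integrable setT (fun x => (k (g i x) * \prod_(j <- s1 ++ s2) g j x)%:E) /\
    \int[P]_x (k (g i x) * \prod_(j <- s1 ++ s2) g j x)%:E =
    \int[P]_x (k (g i x))%:E * \prod_(j <- s1 ++ s2) \int[P]_x (g j x)%:E.
  move=> mk kle k0.
  have EE x : (k (g i x) * \prod_(j <- s1 ++ s2) g j x =
      \prod_(j <- i :: s1 ++ s2) g' k j x)%R.
    rewrite big_cons g'i; congr (_ * _)%R; rewrite big_seq [RHS]big_seq.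
    by apply: eq_bigr => j js; rewrite g'E.
  have -> : (fun x => (k (g i x) * \prod_(j <- s1 ++ s2) g j x)%:E) =
      (fun x => (\prod_(j <- i :: s1 ++ s2) g' k j x)%:E).
    by apply/funext => x; rewrite EE.
  split; first by apply: integrable_prod_indep => //;[exact: g'ad|exact: g'int].
  rewrite (IH (i :: s1) (g' k))//; last 3 first.
  - exact: g'ad.
  - exact: g'int.
  - move=> j; rewrite inE => /orP[/eqP ->|js] x; first by rewrite g'i; exact: k0.
    by rewrite g'E ?mem_cat ?js//; exact: f0.
  rewrite big_cons; congr (_ * _); first by rewrite g'i.
  by rewrite big_seq [RHS]big_seq; apply: eq_bigr => j js; rewrite g'E.
pose kp (y : R) : R := (Num.max y 0)%R.
pose kn (y : R) : R := (Num.max (- y) 0)%R.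
have mkp : measurable_fun setT kp by exact: measurable_maxr.
have mkn : measurable_fun setT kn.
  by apply: measurable_maxr => //; exact: measurable_oppr.
have kpn y : y = (kp y - kn y)%R.
  by rewrite /kp /kn; case: (leP y (0%R : R)) => y0;
    [rewrite max_l ?oppr_ge0// sub0r opprK|rewrite max_r ?oppr_le0 ?subr0// ltW].
have kple y : (`|kp y| <= `|y|)%R.
  by rewrite /kp; case: (leP y (0%R : R)); rewrite ?normr0.
have knle y : (`|kn y| <= `|y|)%R.
  by rewrite /kn; case: (leP (- y)%R (0%R : R)); rewrite ?normr0 ?normrN.
have kp0 y : (0 <= kp y)%R by rewrite /kp le_max lexx orbT.
have kn0 y : (0 <= kn y)%R by rewrite /kn le_max lexx orbT.
have [ip ep] := key kp mkp kple kp0.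
have [im em] := key kn mkn knle kn0.
under eq_integral do rewrite big_cons {1}[g i _]kpn mulrBl EFinB.
rewrite integralB//= ep em big_cons.
have -> : \int[P]_x (g i x)%:E =
    \int[P]_x (kp (g i x))%:E - \int[P]_x (kn (g i x))%:E.
  under eq_integral do rewrite [g i _]kpn EFinB.
  rewrite integralB//.
  - by have := g'int kp mkp kple i ii; rewrite g'i.
  - by have := g'int kn mkn knle i ii; rewrite g'i.
have fp : \int[P]_x (kp (g i x))%:E \is a fin_num.
  apply: integrable_fin_num => //.
  by have := g'int kp mkp kple i ii; rewrite g'i.
have fr : \prod_(j <- s1 ++ s2) \int[P]_x (g j x)%:E \is a fin_num.
  rewrite big_seq prode_fin_num// => j js; apply: integrable_fin_num => //.
  by apply: fi; exact: sS.
move: fp fr.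
move: (\int[P]_x (kp (g i x))%:E) (\int[P]_x (kn (g i x))%:E) => a b fa fr.
by rewrite muleBl// fin_num_adde_defr.
Qed.

End IndependentProducts.

(** * Pointwise formula for the test error, and bounds on its coefficients *)

Section EstimatorAlgebra.
Variable R : realType.

(** Only the nuclear case involves [U]. From [gU], g_i U_ij = U_ij ev_j, so g_i = ev_j wherever U_ij
    is nonzero. Hence [U] also intertwines the diagonal matrices of max(g_i, alpha) and max(ev_j,
    alpha). *)
Lemma biased_gram_diag (m : nat) (p : bias) (alpha : R) (g : 'rV[R]_m)
    (U : 'M[R]_m) (ev : 'rV[R]_m) :
  orthogonal_diagonalization (diag_mx g) U ev ->
  biased_gram p alpha (diag_mx g) U ev =
  diag_mx (\row_i shrinkage p alpha (g 0 i)).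
Proof.
move=> [UtU gE]; have UUt : U *m U^T = 1%:M by exact: mulmx1C.
case: p => /=.
- have gU : diag_mx g *m U = U *m diag_mx ev.
    by rewrite gE -mulmxA UtU mulmx1.
  suff -> : U *m diag_mx (\row_i Num.max (ev 0 i) alpha) =
      diag_mx (\row_i Num.max (g 0 i) alpha) *m U.
    by rewrite -mulmxA UUt mulmx1.
  apply/matrixP => i j; have /matrixP/(_ i j) := gU.
  rewrite !mul_mx_diag !mul_diag_mx !mxE.
  have [->|Uij0] := eqVneq (U i j) 0; first by rewrite !mulr0 !mul0r.
  by rewrite [RHS]mulrC => /(mulIf Uij0) ->; rewrite mulrC.
- by apply/matrixP => i j; rewrite !mxE; case: (i == j); rewrite ?mulr1n// !mulr0n addr0.
- by apply/matrixP => i j; rewrite !mxE mulrnAr mulrC.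
Qed.

Lemma gram_scaled_frame (N m : nat) (X : 'M[R]_(N, m)) (v : 'rV[R]_m) :
  X^T *m X = 1%:M ->
  (X *m diag_mx v)^T *m (X *m diag_mx v) = diag_mx (\row_i v 0 i ^+ 2).
Proof.
move=> XX; rewrite trmx_mul tr_diag_mx -mulmxA (mulmxA X^T) XX mul1mx.
apply/matrixP => i j; rewrite mul_mx_diag !mxE.
by case: eqVneq => [->|_]; rewrite ?mulr1n ?expr2// mulr0n mul0r.
Qed.

Lemma sqnorm_scaled_frame (N m : nat) (X : 'M[R]_(N, m)) (v : 'rV[R]_m)
    (w : 'cV[R]_m) :
  X^T *m X = 1%:M ->
  sqnorm (X *m diag_mx v *m w) = \sum_i v 0 i ^+ 2 * w i 0 ^+ 2.
Proof.
have sqE k (u : 'cV[R]_k) : sqnorm u = (u^T *m u) 0 0.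
  by rewrite mxE; apply: eq_bigr => i _; rewrite !mxE expr2.
move=> XX; set Y := X *m diag_mx v.
rewrite sqE trmx_mul -mulmxA (mulmxA Y^T) /Y gram_scaled_frame//.
rewrite mul_diag_mx mxE; apply: eq_bigr => i _.
by rewrite !mxE mulrCA expr2.
Qed.

Variables (p : bias) (alpha : R).

Definition shrink_ratio (x : R) := x / shrinkage p alpha x.
(** With r the shrink ratio, this and the next two are the coefficients of b^2, y^2 and 2by in the
    square of sqrt(x) (r - 1) b + r y. *)
Definition bias_coef (x : R) := x * (1 - shrink_ratio x) ^+ 2.
Definition noise_coef (x : R) := shrink_ratio x ^+ 2.
Definition cross_coef (x : R) :=
  Num.sqrt x * shrink_ratio x * (shrink_ratio x - 1).

(** All matrices become diagonal: with y = X1^T e, the i-th estimation error is (r_i - 1) b_i +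
    sqrt(l_i) y_i / f_i. Orthonormality of [X2] weights its square by l_i s_i, and multiplying the
    error by sqrt(l_i) turns the last term into r_i y_i. *)
Lemma sqnorm_test_error (N m : nat) (X1 X2 : 'M[R]_(N, m)) (l s : 'I_m -> R)
    (b : 'cV[R]_m) (e : 'cV[R]_N) (U : 'M[R]_m) (ev : 'rV[R]_m)
    (X := X1 *m diag_mx (\row_i Num.sqrt (l i)))
    (Z := X2 *m diag_mx (\row_i Num.sqrt (l i * s i))) :
  0 <= alpha -> (forall i, 0 < l i) -> (forall i, 0 <= s i) ->
  X1^T *m X1 = 1%:M -> X2^T *m X2 = 1%:M ->
  orthogonal_diagonalization (X^T *m X) U ev ->
  sqnorm (Z *m biased_estimator p alpha X (X *m b + e) U ev - Z *m b) =
  \sum_i s i * (Num.sqrt (l i) * (shrink_ratio (l i) - 1) * b i 0 +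
    shrink_ratio (l i) * (X1^T *m e) i 0) ^+ 2.
Proof.
move=> alpha0 l0 s0 XX1 XX2; rewrite /biased_estimator.
have XX : X^T *m X = diag_mx (\row_i l i).
  rewrite gram_scaled_frame//; congr diag_mx; apply/rowP => i.
  by rewrite !mxE sqr_sqrtr// ltW.
rewrite XX => /(biased_gram_diag p alpha) ->.
have f0 i : 0 < shrinkage p alpha (l i).
  case: p => /=; first by rewrite lt_max l0.
    by rewrite ltr_pwDl.
  by rewrite mulr_gt0// ltr_pwDl.
set f := \row_i _.
have -> : invmx (diag_mx f) = diag_mx (\row_i (f 0 i)^-1).
  have DD : diag_mx f *m diag_mx (\row_i (f 0 i)^-1) = 1%:M.
    apply/matrixP => i j; rewrite mul_diag_mx !mxE.
    case: eqVneq => [->|_]; rewrite ?mulr0n ?mulr0// mulr1n divff//.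
    by rewrite gt_eqF.
  have [uf _] := mulmx1_unit DD.
  by rewrite -[LHS]mulmx1 -DD mulmxA mulVmx// mul1mx.
rewrite -mulmxBr sqnorm_scaled_frame//; apply: eq_bigr => i _.
rewrite [in LHS]mxE sqr_sqrtr; last by rewrite mulr_ge0// ltW.
rewrite [l i * s i]mulrC -[LHS]mulrA; congr (_ * _).
move yE : ((X1^T *m e) i 0) => y.
have -> : (diag_mx (\row_i0 (f 0 i0)^-1) *m X^T *m (X *m b + e) - b) i 0 =
    (f 0 i)^-1 * (l i * b i 0 + Num.sqrt (l i) * y) - b i 0.
  rewrite -mulmxA mul_diag_mx mulmxDr mulmxA XX mul_diag_mx trmx_mul.
  rewrite tr_diag_mx -mulmxA mul_diag_mx -yE.
  by move: (X1^T *m e) => E; rewrite !mxE.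
rewrite /shrink_ratio !mxE.
set g := (shrinkage p alpha (l i))^-1.
have := sqr_sqrtr (ltW (l0 i)); set q := Num.sqrt (l i) => qE.
by rewrite -qE; ring.
Qed.

Lemma sqr_test_error (x b y : R) : 0 <= x ->
  (Num.sqrt x * (shrink_ratio x - 1) * b + shrink_ratio x * y) ^+ 2 =
  bias_coef x * b ^+ 2 + 2 * cross_coef x * b * y + noise_coef x * y ^+ 2.
Proof.
move=> x0; rewrite /bias_coef /cross_coef /noise_coef -{4}(sqr_sqrtr x0).
by ring.
Qed.

Hypothesis alpha0 : 0 <= alpha.

Lemma shrinkage_ge (x : R) : 0 <= x -> x <= shrinkage p alpha x.
Proof.
move=> x0; case: p => /=; rewrite ?le_max ?lexx ?lerDl//.
by rewrite ler_peMr// lerDl.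
Qed.

Lemma shrink_ratio_ge0 (x : R) : 0 <= x -> 0 <= shrink_ratio x.
Proof.
by move=> x0; rewrite divr_ge0// (le_trans x0)// shrinkage_ge.
Qed.

Lemma shrink_ratio_le1 (x : R) : 0 <= x -> shrink_ratio x <= 1.
Proof.
move=> x0; have := shrinkage_ge x0; rewrite /shrink_ratio => xf.
(* The shrinkage may vanish at x = 0; the ratio is then 0 because the inverse of 0 is 0. *)
have [->|f0] := eqVneq (shrinkage p alpha x) 0; first by rewrite invr0 mulr0.
by rewrite ler_pdivrMr ?mul1r// lt_neqAle eq_sym f0 (le_trans x0).
Qed.

Lemma shrink_ratio0 : shrink_ratio 0 = 0.
Proof. by rewrite /shrink_ratio mul0r. Qed.

Lemma bias_coef_bounded (x : R) : 0 <= x <= 1 -> `|bias_coef x| <= 1.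
Proof.
move=> /andP[x0 x1]; have r0 := shrink_ratio_ge0 x0.
have r1 := shrink_ratio_le1 x0.
rewrite ger0_norm; last by rewrite mulr_ge0// sqr_ge0.
apply: mulr_ile1 => //; first exact: sqr_ge0.
by rewrite exprn_ile1// ?subr_ge0// lerBlDl lerDr.
Qed.

Lemma noise_coef_bounded (x : R) : 0 <= x -> `|noise_coef x| <= 1.
Proof.
move=> x0; have r0 := shrink_ratio_ge0 x0.
have r1 := shrink_ratio_le1 x0.
by rewrite ger0_norm; [rewrite exprn_ile1|exact: sqr_ge0].
Qed.

Lemma cross_coef_bounded (x : R) : 0 <= x <= 1 -> `|cross_coef x| <= 1.
Proof.
move=> /andP[x0 x1]; have r0 := shrink_ratio_ge0 x0.
have r1 := shrink_ratio_le1 x0.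
rewrite 2!normrM; apply: mulr_ile1 => //; first apply: mulr_ile1 => //.
- by rewrite ger0_norm ?sqrtr_ge0// -[leRHS]sqrtr1 ler_wsqrtr.
- by rewrite ger0_norm.
- by rewrite ler0_norm ?subr_le0// opprB lerBlDl lerDr.
Qed.

Lemma measurable_shrink_ratio (D : set R) : D `<=` [set x | 0 <= x] ->
  measurable_fun D shrink_ratio.
Proof.
move=> D0.
(* On nonnegative reals, 0 included, the power -1 coincides with the inverse, so division inherits
   the measurability of the power function. *)
apply: (eq_measurable_fun (fun x : R => x * shrinkage p alpha x `^ (-1))).
  move=> x /set_mem/D0/= x0.
  by rewrite powR_inv1// (le_trans x0)// shrinkage_ge.
apply: measurable_funM => //.
apply: (measurableT_comp (@measurable_powR R (-1))).
case: p => /=.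
- exact: measurable_maxr.
- exact: measurable_funD.
- exact: measurable_funM.
Qed.

End EstimatorAlgebra.

(** * Calculus of finite means *)

Section HasMean.
Context d (T : measurableType d) (R : realType) (P : probability T R).

(** Integrability is bundled with a real value of the integral, so that sums, multiples and products
    of means are computed in the reals without side conditions on finiteness. *)
Definition has_mean (f : T -> R) (r : R) :=
  P.-integrable setT (EFin \o f) /\ (\int[P]_x (f x)%:E = r%:E)%E.

Lemma eq_has_mean f g r : f =1 g -> has_mean f r -> has_mean g r.
Proof. by move=> /funext ->. Qed.

Lemma has_mean_unique f r s : has_mean f r -> has_mean f s -> r = s.
Proof. by move=> [_ fr] [_]; rewrite fr => -[]. Qed.

Lemma has_mean_cst r : has_mean (cst r) r.
Proof.
split; last by rewrite (@integral_cst _ _ _ P _ measurableT r%:E)/= probability_setT mule1.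
by apply: finite_measure_integrable_cst.
Qed.

Lemma has_meanD f g r s : has_mean f r -> has_mean g s ->
  has_mean (fun x => f x + g x) (r + s).
Proof.
move=> [fi fE] [gi gE]; split.
  by rewrite (_ : _ \o _ = (EFin \o f) \+ (EFin \o g))%E//; exact: integrableD.
by under eq_integral do rewrite EFinD; rewrite integralD//= fE gE.
Qed.

Lemma has_meanZ c f r : has_mean f r -> has_mean (fun x => c * f x) (c * r).
Proof.
move=> [fi fE]; split.
  rewrite (_ : _ \o _ = (fun x => c%:E * (EFin \o f) x)%E)//.
  exact: integrableZl.
under eq_integral do rewrite EFinM.
by rewrite (integralZl measurableT fi) fE.
Qed.

Lemma has_mean_sum (J : Type) (s : seq J) (f : J -> T -> R) (r : J -> R) :
  (forall j, has_mean (f j) (r j)) ->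
  has_mean (fun x => \sum_(j <- s) f j x) (\sum_(j <- s) r j).
Proof.
move=> fr; elim: s => [|j s IH].
  by rewrite big_nil; apply: eq_has_mean (has_mean_cst 0) => x; rewrite big_nil.
rewrite big_cons; apply: eq_has_mean (has_meanD (fr j) IH) => x.
by rewrite big_cons.
Qed.

Lemma has_mean_prod (I : finType) (F : I -> set_system T) (s : seq I)
    (f : I -> T -> R) (r : I -> R) :
  (forall i, F i `<=` measurable) -> mutually_independent P F ->
  uniq s -> adapted F s f -> (forall i, i \in s -> has_mean (f i) (r i)) ->
  has_mean (fun x => \prod_(i <- s) f i x) (\prod_(i <- s) r i).
Proof.
move=> mF indF us sf fr.
have fi i : i \in s -> P.-integrable setT (EFin \o f i) by move=> /fr[].
split; first exact: (integrable_prod_indep mF indF).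
rewrite (integral_prod_indep mF indF)// -prodEFin big_seq [RHS]big_seq.
by apply: eq_bigr => i /fr[].
Qed.

Lemma has_mean_bounded (f : T -> R) (c : R) :
  measurable_fun setT f -> (forall x, `|f x| <= c) ->
  has_mean f (fine (\int[P]_x (f x)%:E)).
Proof.
move=> mf fc.
have fi : P.-integrable setT (EFin \o f).
  apply: measurable_bounded_integrable => //.
    by apply: le_lt_trans (ltry 1); exact: probability_le1.
  exists c; split; first exact: num_real.
  by move=> y cy x _; exact: le_trans (fc x) (ltW cy).
by split => //; rewrite fineK//; exact: integrable_fin_num.
Qed.

Lemma has_mean_law (X : {RV P >-> R}) (nu : probability R R) (g : R -> R)
    (c : R) :
  (forall A : set R, measurable A -> distribution P X A = nu A) ->
  measurable_fun setT g -> (forall x, `|g x| <= c) ->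
  has_mean (g \o X) (fine (\int[nu]_x (g x)%:E)).
Proof.
move=> Xnu mg gc.
have mgX : measurable_fun setT (g \o X) by exact: measurableT_comp.
have [gi gE] := has_mean_bounded mgX (fun x => gc (X x)).
split => //; rewrite gE; congr (fine _)%:E.
rewrite -(@integral_distribution _ _ _ _ _ P X (EFin \o g))//; last first.
  exact/measurable_EFinP.
by apply: eq_measure_integral => A mA _; exact: Xnu.
Qed.

End HasMean.

(** * Truncation to the supports of the laws, giving coefficients measurable on the whole line *)

Section Truncation.
Variable R : realType.

(* Sends the points outside [[a, b]] to [0], not to the nearest endpoint. *)
Definition clip (a b x : R) : R := x * \1_(`[a, b]%classic) x.

Lemma clip_id a b x : a <= x <= b -> clip a b x = x.
Proof.
by move=> xab; rewrite /clip indicE mem_set ?mulr1//= in_itv.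
Qed.

Lemma clip_itv a b x : 0 <= a -> 0 <= b -> 0 <= clip a b x <= b.
Proof.
move=> a0 b0; rewrite /clip indicE.
have [/set_mem/=|_] := boolP (_ \in _); last by rewrite mulr0 lexx.
by rewrite in_itv/= mulr1 => /andP[ax ->]; rewrite (le_trans a0).
Qed.

Lemma measurable_clip a b : measurable_fun setT (clip a b).
Proof. by apply: measurable_funM => //; exact: measurable_indic. Qed.

Lemma integral_clip (nu : probability R R) a b : nu `[a, b]%classic = 1%E ->
  (\int[nu]_x (clip a b x)%:E = \int[nu]_x x%:E)%E.
Proof.
move=> nuab; apply: ae_eq_integral => //.
  by apply/measurable_EFinP; exact: measurable_clip.
exists (~` `[a, b]%classic); split; first exact: measurableC.
  by rewrite [LHS]probability_setC// nuab subee.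
by move=> x /=; apply: contra_not => xab _; rewrite clip_id// -in_itv.
Qed.

Variables (p : bias) (alpha : R).
Hypothesis alpha0 : 0 <= alpha.

Lemma measurable_clip_ratio :
  measurable_fun setT (shrink_ratio p alpha \o clip 0 1).
Proof.
have mI : measurable (`[0, +oo[%classic : set R) by exact: measurable_itv.
apply: (measurable_comp mI).
- by move=> _ [x _ <-] /=; rewrite in_itv/= andbT; have /andP[] := clip_itv x (lexx 0) ler01.
- by apply: measurable_shrink_ratio => // x /=; rewrite in_itv/= andbT.
- exact: measurable_clip.
Qed.

Lemma measurable_clip_bias : measurable_fun setT (bias_coef p alpha \o clip 0 1).
Proof.
apply: measurable_funM; first exact: measurable_clip.
apply: measurable_funX; apply: measurable_funB => //.
exact: measurable_clip_ratio.
Qed.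

Lemma measurable_clip_noise : measurable_fun setT (noise_coef p alpha \o clip 0 1).
Proof. by apply: measurable_funX; exact: measurable_clip_ratio. Qed.

Lemma measurable_clip_cross : measurable_fun setT (cross_coef p alpha \o clip 0 1).
Proof.
apply: measurable_funM; first apply: measurable_funM.
- apply: measurableT_comp; last exact: measurable_clip.
  exact: continuous_measurable_fun (@sqrt_continuous R).
- exact: measurable_clip_ratio.
- by apply: measurable_funB => //; exact: measurable_clip_ratio.
Qed.

End Truncation.

(** Open rays generate the Borel sets of the line, and a coordinate, being continuous, pulls them
    back to open sets of matrices. *)
Lemma measurable_coord (R : realType) (N m : nat) (k : 'I_N) (i : 'I_m) :
  measurable_fun setT (fun M : borel_mx R N m => (M : 'M[R]_(N, m)) k i).
Proof.
apply: (measurability _ (RGenOInfty.measurableE R)) => _ [_ [x ->]] <-.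
rewrite setTI; apply: sub_sigma_algebra.
apply: (@open_comp _ _ (fun M : 'M[R]_(N, m) => M k i)).
  by move=> M _; exact: coord_continuous.
exact: rray_open.
Qed.

(** * Exact expectation of the test error at fixed dimensions *)

Section SampleMean.
Context (disp : measure_display) (T : measurableType disp) (R : realType)
  (P : probability T R) (N m : nat) (D : sample P N m).
Variables (nu nu_noise : probability R R) (sigma a b alpha : R) (p : bias).
Hypothesis law : sampled_from D nu nu_noise sigma.
Hypothesis nu_supp : nu `[0, 1]%classic = 1%E.
Hypothesis nu0 : nu [set 0] = 0%E.
Hypothesis a_ge0 : 0 <= a.
Hypothesis noise_supp : nu_noise `[a, b]%classic = 1%E.
Hypothesis noise_mean : (\int[nu_noise]_x x%:E = 1)%E.
Hypothesis alpha_ge0 : 0 <= alpha.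

Let source : finType := ('I_m + 'I_m + (unit + unit) + 'I_N)%type.
Let F := sample_sigma_algebra D.

Lemma sample_sigma_algebra_measurable i : F i `<=` measurable.
Proof.
case: i => [[[i|i]|[u|u]]|i] _ [B mB <-]; exact: measurable_funPT.
Qed.

(** Indexed like [sample_sigma_algebra], so that products of functions of different sources fall
    under the product rule for independent factors. *)
Definition sample_fun (gl gs : R -> R) (g1 g2 : borel_mx R N m -> R)
    (ge : 'I_N -> R -> R) (i : source) : T -> R :=
  match i with
  | inl (inl (inl i)) => gl \o ell D i
  | inl (inl (inr i)) => gs \o scl D i
  | inl (inr (inl _)) => g1 \o frame1 D
  | inl (inr (inr _)) => g2 \o frame2 D
  | inr i => ge i \o eps D i
  end.

Lemma adapted_sample_fun s gl gs g1 g2 ge :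
  measurable_fun setT gl -> measurable_fun setT gs -> measurable_fun setT g1 ->
  measurable_fun setT g2 -> (forall i, measurable_fun setT (ge i)) ->
  adapted F s (sample_fun gl gs g1 g2 ge).
Proof.
have pre d2 (T2 : measurableType d2) (X : T -> T2)
    (g : T2 -> R) B : measurable_fun setT g -> measurable B ->
    g_sigma_algebra_preimage X ((g \o X) @^-1` B).
  move=> mg mB; exists (g @^-1` B); last by rewrite setTI.
  by rewrite -[_ @^-1` _]setTI; exact: mg.
by move=> ? ? ? ? ? [[[i|i]|[u|u]]|i] _ B mB /=; apply: pre.
Qed.

Lemma frame1_entry_sum w i : \sum_k (frame1 D w : 'M[R]_(N, m)) k i ^+ 2 = 1.
Proof.
have [/(_ w)/matrixP/(_ i i) + _] := frame1_law law.
rewrite !mxE eqxx mulr1n => <-.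
by apply: eq_bigr => k _; rewrite mxE expr2.
Qed.

(** The columns are unit vectors. This bound makes the frame entries and their products
    integrable. *)
Lemma frame1_entry_le1 w k i : `|(frame1 D w : 'M[R]_(N, m)) k i| <= 1.
Proof.
rewrite -(@ler_pXn2r _ 2) ?nnegrE// expr1n real_normK ?num_real//.
rewrite -(frame1_entry_sum w i) (bigD1 k)//= lerDl.
by apply: sumr_ge0 => j _; exact: sqr_ge0.
Qed.

Lemma good_sample_ae :
  {ae P, forall w, (forall i, 0 < ell D i w <= 1) /\
                   (forall i, a <= scl D i w <= b)}.
Proof.
have H (X : {RV P >-> R}) (mu : probability R R) (A : set R) :
    (forall B : set R, measurable B -> distribution P X B = mu B) ->
    measurable A -> mu A = 1%E -> {ae P, forall w, A (X w)}.
  move=> law_X mA muA; exists (X @^-1` ~` A); split => //.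
    by apply: measurable_funPTI; exact: measurableC.
  have -> : P (X @^-1` (~` A)) = distribution P X (~` A) by [].
  rewrite law_X; last exact: measurableC.
  by rewrite [LHS]probability_setC// muA subee.
(* Absence of an atom at 0 removes the endpoint, so that almost surely every [ell] is positive and
   the Gram matrix invertible. *)
have nu01 : nu `]0, 1]%classic = 1%E.
  have : nu (`[0, 1]%classic) = (nu [set 0%R] + nu `]0%R, 1%R]%classic)%E.
    rewrite -measureU//; last first.
      by apply/seteqP; split => // x [/= ->]; rewrite in_itv/= ltxx.
    congr (nu _); apply/seteqP; split => x /=; rewrite !in_itv/=.
      by rewrite le_eqVlt => /andP[/orP[/eqP <-|x0] x1];[left|right; rewrite x0].
    by move=> [->|/andP[/ltW -> ->//]]; rewrite lexx ler01.
  by rewrite nu0 add0e nu_supp => <-.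
have H1 : {ae P, forall w, forall i, 0 < ell D i w <= 1}.
  apply: filter_forall => i; have := H _ _ _ (@ell_law _ _ _ _ _ _ _ _ _ _ law i) _ nu01.
  move=> /(_ (measurable_itv _)); apply: filterS => w /=; by rewrite in_itv.
have H2 : {ae P, forall w, forall i, a <= scl D i w <= b}.
  apply: filter_forall => i; have := H _ _ _ (@scl_law _ _ _ _ _ _ _ _ _ _ law i) _ noise_supp.
  move=> /(_ (measurable_itv _)); apply: filterS => w /=; by rewrite in_itv.
by apply: filterS2 H1 H2.
Qed.

(** Otherwise b < 0 <= a, and the empty interval would carry mass 1. *)
Lemma noise_supp_ub_ge0 : 0 <= b.
Proof.
rewrite leNgt; apply/negP => b0; have := noise_supp.
rewrite set_itv_ge ?measure0; last by rewrite bnd_simp -ltNge (lt_le_trans b0).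
by move=> /esym/eqP; rewrite onee_eq0.
Qed.

(** Truncated samples: almost surely equal to the original ones, but bounded at every sample
    point. *)
Let l i w := clip 0 1 (ell D i w).
Let s i w := clip a b (scl D i w).
Let X1 w : 'M[R]_(N, m) := frame1 D w.

(** Each term of the expanded square is such a product: one noise scale, a function of one [ell], a
    function of the first frame, and noise entries at distinct indices. Independence makes the mean
    a product, in which the scale contributes 1. *)
Lemma has_mean_sample_prod (h : R -> R) (c : R) (g : 'M[R]_(N, m) -> R)
    (i : 'I_m) (t : seq 'I_N) (ge : 'I_N -> R -> R) (r : 'I_N -> R) :
  measurable_fun setT h -> (forall x, `|h x| <= c) ->
  measurable_fun setT (g : borel_mx R N m -> R) -> (forall w, `|g (X1 w)| <= 1) ->
  uniq t -> (forall k, measurable_fun setT (ge k)) ->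
  (forall k, k \in t -> has_mean P (ge k \o eps D k) (r k)) ->
  has_mean P (fun w => s i w * (h (ell D i w) *
     (g (X1 w) * \prod_(k <- t) ge k (eps D k w))))
   (fine (\int[nu]_x (h x)%:E)
     * (fine (\int[P]_w (g (X1 w))%:E) * \prod_(k <- t) r k)).
Proof.
move=> mh hc mg g1 ut mge ger.
pose f := sample_fun h (clip a b) g (cst 0) ge.
(* The sources of the factors, in the order in which the statement multiplies them. *)
pose idx : seq source := [:: inl (inl (inr i)), inl (inl (inl i)),
  inl (inr (inl tt)) & [seq inr k | k <- t]].
pose rr (j : source) : R := match j with
  | inl (inl (inl i)) => fine (\int[nu]_x (h x)%:E)
  | inl (inl (inr i)) => 1
  | inl (inr (inl _)) => fine (\int[P]_w (g (X1 w))%:E)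
  | inl (inr (inr _)) => 0
  | inr k => r k
  end.
have uidx : uniq idx.
  rewrite /= !inE /= map_inj_uniq//; last by move=> ? ? [].
  rewrite ut andbT; apply/and3P; split => //; by apply/mapP => -[].
have fad : adapted F idx f.
  by apply: adapted_sample_fun => //; exact: measurable_clip.
have := @has_mean_prod _ _ _ P _ F idx f rr sample_sigma_algebra_measurable
  (all_indep law) uidx fad.
rewrite !big_cons !big_map /= mul1r => H.
apply: eq_has_mean (H _) => [w|j]; first by rewrite !big_cons big_map.
rewrite !inE => /or4P[/eqP ->|/eqP ->|/eqP ->|/mapP[k kt ->]] /=.
- have -> : 1 = fine (\int[nu_noise]_x (clip a b x)%:E).
    by rewrite integral_clip// noise_mean.
  apply: (has_mean_law (scl_law law i) (measurable_clip a b) (c := b)) => x.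
  have /andP[c0 cb] := clip_itv x a_ge0 noise_supp_ub_ge0.
  by rewrite ger0_norm.
- exact: (has_mean_law (ell_law law i) mh hc).
- apply: (@has_mean_bounded _ _ _ P (fun w => g (X1 w)) 1) g1.
  exact: (measurableT_comp mg (@measurable_funPT _ _ _ _ (frame1 D))).
- exact: ger.
Qed.

Lemma has_mean_eps k : has_mean P (eps D k) 0.
Proof.
have L1 : (eps D k : T -> R) \in Lfun P 1.
  by apply: Lfun_subset12 (eps_L2 law k); exact: fin_num_measure.
split; first exact/Lfun1_integrable.
by have := eps_mean law k; rewrite unlock.
Qed.

Lemma has_mean_eps_sqr k : has_mean P (fun w => eps D k w ^+ 2) (sigma ^+ 2).
Proof.
split; first exact: Lfun2_integrable_sqr (eps_L2 law k).
have := eps_var law k; rewrite varianceE ?(eps_L2 law)// (eps_mean law k).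
by rewrite expe2 mule0 sube0 unlock.
Qed.

(** This and [mean_noise] are the two averages in the limit. Clipping makes the integrands vanish
    off [0, 1], as both coefficients are 0 at 0. *)
Definition mean_bias := fine (\int[nu]_x (bias_coef p alpha (clip 0 1 x))%:E).
Definition mean_noise := fine (\int[nu]_x (noise_coef p alpha (clip 0 1 x))%:E).

Lemma has_mean_test_error (b0 : R) i :
  has_mean P (fun w => s i w *
    (Num.sqrt (l i w) * (shrink_ratio p alpha (l i w) - 1) * b0 +
     shrink_ratio p alpha (l i w) * ((X1 w)^T *m \col_k eps D k w) i 0) ^+ 2)
  (b0 ^+ 2 * mean_bias + sigma ^+ 2 * mean_noise).
Proof.
have clip01 (x : R) : 0 <= clip 0 1 x <= 1 by exact: clip_itv.
have mA := measurable_clip_bias p alpha_ge0.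
have mB := measurable_clip_noise p alpha_ge0.
have mC := measurable_clip_cross p alpha_ge0.
have cA x : `|(bias_coef p alpha \o clip 0 1) x| <= 1 by exact: bias_coef_bounded.
have cC x : `|(cross_coef p alpha \o clip 0 1) x| <= 1 by exact: cross_coef_bounded.
have cB x : `|(noise_coef p alpha \o clip 0 1) x| <= 1.
  by apply: noise_coef_bounded => //; have /andP[] := clip01 x.
have mX k j : measurable_fun setT (fun M : borel_mx R N m => (M : 'M[R]_(N, m)) k j).
  exact: measurable_coord.
have mid (k : 'I_N) : measurable_fun setT (id : R -> R) by [].
have e1 : has_mean P (fun w => b0 ^+ 2 *
    (s i w * bias_coef p alpha (l i w))) (b0 ^+ 2 * mean_bias).
  have n1 (w : T) : `|(1 : R)| <= 1 by rewrite normr1.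
  have m1 : measurable_fun setT (fun M : borel_mx R N m => 1 : R) by [].
  apply: has_meanZ; have := @has_mean_sample_prod _ 1 (fun=> 1) i [::] (fun=> id)
    (fun=> 0) mA cA m1 n1 isT mid.
  rewrite !big_nil mulr1.
  rewrite (_ : fine (\int[P]_w 1%:E) = 1); last first.
    by rewrite (@integral_cst _ _ _ P _ measurableT 1)/= probability_setT mule1.
  rewrite mulr1 => H; apply: eq_has_mean (H _) => [w|k].
    by rewrite big_nil !mulr1.
  by rewrite in_nil.
(* Cross terms: the single factor [eps D k] is centred. *)
have e2 k : has_mean P (fun w => s i w * (cross_coef p alpha (l i w) *
     (X1 w k i * eps D k w))) 0.
  have := @has_mean_sample_prod _ 1 (fun M => M k i) i [:: k] (fun=> id)
    (fun=> 0) mC cC (mX k i) (fun w => frame1_entry_le1 w k i) isT mid.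
  rewrite !big_seq1 !mulr0 => H; apply: eq_has_mean (H _) => [w|j _].
    by rewrite big_seq1.
  exact: has_mean_eps.
pose h k := fine (\int[P]_w (X1 w k i ^+ 2)%:E).
have mX2 k j : measurable_fun setT (fun M : borel_mx R N m =>
    (M : 'M[R]_(N, m)) k i * (M : 'M[R]_(N, m)) j i).
  exact: measurable_funM.
have X2le1 k j w : `|X1 w k i * X1 w j i| <= 1.
  by rewrite normrM mulr_ile1// frame1_entry_le1.
have e3 k j : has_mean P (fun w => s i w * (noise_coef p alpha (l i w) *
     ((X1 w k i * X1 w j i) * (eps D k w * eps D j w))))
     (if k == j then mean_noise * (h k * sigma ^+ 2) else 0).
  case: eqVneq => [<-|kj].
    have := @has_mean_sample_prod _ 1 (fun M => M k i * M k i) i [:: k]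
      (fun=> fun x => x ^+ 2) (fun=> sigma ^+ 2) mB cB (mX2 k k) (X2le1 k k) isT.
    rewrite !big_seq1 => H; apply: eq_has_mean (H _ _) => [w|j'|j' _].
    - by rewrite big_seq1 -expr2.
    - exact: measurable_funX.
    - exact: has_mean_eps_sqr.
  (* Off the diagonal, two independent centred noise entries make the mean 0. *)
  have := @has_mean_sample_prod _ 1 (fun M => M k i * M j i) i [:: k; j]
    (fun=> id) (fun=> 0) mB cB (mX2 k j) (X2le1 k j) _ mid.
  rewrite /= inE kj !big_cons mul0r !mulr0 => H.
  apply: eq_has_mean (H isT _) => [w|j' _].
    by rewrite !big_cons big_nil mulr1.
  exact: has_mean_eps.
(* The second moments [h k] enter only through their sum, the mean of the squared norm of a unit
   column. *)
have hsum : \sum_k h k = 1.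
  have h1 k : has_mean P (fun w => X1 w k i ^+ 2) (h k).
    apply: (@has_mean_bounded _ _ _ P _ 1).
      apply: measurable_funX.
      by apply: (measurableT_comp (mX k i)).
    by move=> w; rewrite expr2.
  have := has_mean_sum (index_enum 'I_N) h1.
  move=> H; apply: (has_mean_unique H).
  by apply: eq_has_mean (has_mean_cst P 1) => w; rewrite frame1_entry_sum.
have e2s := has_meanZ (2 * b0) (has_mean_sum (index_enum 'I_N) e2).
have e3s := has_mean_sum (index_enum 'I_N)
  (fun k => has_mean_sum (index_enum 'I_N) (e3 k)).
have := has_meanD (has_meanD e1 e2s) e3s.
have -> : \sum_(k < N) \sum_(j < N)
    (if k == j then mean_noise * (h k * sigma ^+ 2) else 0) =
    sigma ^+ 2 * mean_noise.
  transitivity (\sum_k mean_noise * (h k * sigma ^+ 2)).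
    apply: eq_bigr => k _; rewrite (bigD1 k)//= eqxx big1 ?addr0// => j.
    by rewrite eq_sym => /negbTE ->.
  by rewrite -mulr_sumr -mulr_suml hsum mul1r mulrC.
rewrite big1// mulr0 addr0; apply: eq_has_mean => w.
rewrite sqr_test_error//; last by have /andP[] := clip01 (ell D i w).
set y := (_ *m _) i 0.
have yE : y = \sum_k X1 w k i * eps D k w.
  by rewrite /y mxE; apply: eq_bigr => k _; rewrite !mxE.
have y2E : y ^+ 2 = \sum_k \sum_j (X1 w k i * X1 w j i) * (eps D k w * eps D j w).
  rewrite expr2 yE mulr_suml; apply: eq_bigr => k _; rewrite mulr_sumr.
  by apply: eq_bigr => j _; rewrite mulrACA.
under [X in _ + X]eq_bigr do rewrite -!mulr_sumr.
rewrite -!mulr_sumr -yE -y2E.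
by ring.
Qed.

(** The truncated error [W] has a known mean and equals the MSE off a null set. As [U] and [ev] are
    arbitrary functions of the sample, the MSE need not be measurable; nonnegativity suffices to
    transfer the integral. *)
Lemma expectation_MSE (beta0 : 'cV[R]_m) (U : T -> 'M[R]_m) (ev : T -> 'rV[R]_m) :
  (forall w, orthogonal_diagonalization ((X_tr D w)^T *m X_tr D w) (U w) (ev w)) ->
  'E_P[MSE D beta0 (fun w => biased_estimator p alpha (X_tr D w)
                 (Y_tr D beta0 w) (U w) (ev w))]%E =
  (N%:R^-1 * (sqnorm beta0 * mean_bias + m%:R * (sigma ^+ 2 * mean_noise)))%:E.
Proof.
move=> Udiag.
have [Z [mZ Z0 subZ]] := good_sample_ae.
pose W w := N%:R^-1 * \sum_i s i w *
    (Num.sqrt (l i w) * (shrink_ratio p alpha (l i w) - 1) * beta0 i 0 +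
     shrink_ratio p alpha (l i w) * ((X1 w)^T *m \col_k eps D k w) i 0) ^+ 2.
have s0 i w : 0 <= s i w by have /andP[] := clip_itv (scl D i w) a_ge0 noise_supp_ub_ge0.
have hW := has_meanZ N%:R^-1 (has_mean_sum (index_enum 'I_m)
  (fun i => has_mean_test_error (beta0 i 0) i)).
have sumE : \sum_(i < m) (beta0 i 0 ^+ 2 * mean_bias + sigma ^+ 2 * mean_noise) =
    sqnorm beta0 * mean_bias + m%:R * (sigma ^+ 2 * mean_noise).
  by rewrite big_split/= -mulr_suml sumr_const card_ord [in RHS]mulr_natl.
rewrite -sumE -(proj2 hW) unlock; apply: (ge0_eq_integral_ae mZ) => //.
- move=> w; rewrite lee_fin /MSE mulr_ge0 ?invr_ge0 ?ler0n//.
  by apply: sumr_ge0 => i _; exact: sqr_ge0.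
- move=> w; rewrite lee_fin mulr_ge0 ?invr_ge0 ?ler0n//.
  by apply: sumr_ge0 => i _; rewrite mulr_ge0 ?sqr_ge0.
move=> w /(contra_not (subZ w)) /contrapT [lw sw].
congr EFin; rewrite /MSE; congr (_ * _).
have lE i : l i w = ell D i w.
  by apply: clip_id; have /andP[/ltW -> ->] := lw i.
have sE i : s i w = scl D i w by exact: clip_id.
have [XX1 _] := frame1_law law; have [XX2 _] := frame2_law law.
rewrite /X_test /Y_tr sqnorm_test_error//.
- by apply: eq_bigr => i _; rewrite lE sE.
- by move=> i; have /andP[] := lw i.
- by move=> i; have /andP[/(le_trans a_ge0)] := sw i.
- exact: Udiag.
Qed.

Lemma limit_err_mean (lambda beta : R) :
  limit_err nu p lambda beta sigma alpha =
  (lambda * (beta ^+ 2 * mean_bias + sigma ^+ 2 * mean_noise))%:E.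
Proof.
have clip01 (x : R) : 0 <= clip 0 1 x <= 1 by exact: clip_itv.
have hA := has_mean_bounded nu (measurable_clip_bias p alpha_ge0)
  (fun x => bias_coef_bounded p alpha_ge0 (clip01 x)).
have hB := has_mean_bounded nu (measurable_clip_noise p alpha_ge0)
  (fun x => noise_coef_bounded p alpha_ge0 (proj1 (andP (clip01 x)))).
have [_ hE] := has_meanD (has_meanZ (beta ^+ 2) hA) (has_meanZ (sigma ^+ 2) hB).
rewrite EFinM -[X in (_ * X)%E]hE /limit_err integral_mkcond; congr (_ * _)%E.
apply: eq_integral => x _; rewrite patchE.
case: ifPn => [/set_mem|] x01.
  rewrite /= clip_id; last by move: x01; rewrite /= in_itv.
  congr EFin; rewrite /bias_coef /noise_coef /shrink_ratio.
  by congr (_ + _); [rewrite -mulrA|rewrite exprMn exprVn].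
(* Outside [0, 1] the restricted integrand is 0, and so are the coefficients at the clipped value
   0. *)
have xc : clip 0 1 x = 0 by rewrite /clip indicE (negbTE x01) mulr0.
by rewrite /= xc /bias_coef /noise_coef shrink_ratio0 mul0r expr0n/= !mulr0 addr0.
Qed.

End SampleMean.

(** * Passage to the limit *)

Theorem proposition2p4 (R : realType) (lambda beta sigma alpha : R) (p : bias)
    (nu nu_noise : probability R R)
    (lambda_gt0 : 0 < lambda) (lambda_lt1 : lambda < 1)
    (beta_gt0 : 0 < beta) (sigma_ge0 : 0 <= sigma) (alpha_ge0 : 0 <= alpha)
    (nu_supp : nu `[0, 1]%classic = 1%E) (nu0 : nu [set 0] = 0%E)
    (nu_noise_supp : exists a b : R, 0 <= a /\ nu_noise `[a, b]%classic = 1%E)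
    (nu_noise_mean : (\int[nu_noise]_x x%:E = 1)%E)
    (N d : nat -> nat) (d_le_N : forall n, (d n <= N n)%N)
    (N_infty : N n @[n --> \oo] --> \oo)
    (d_infty : d n @[n --> \oo] --> \oo)
    (dN_cvg : (d n)%:R / (N n)%:R @[n --> \oo] --> lambda)
    (beta0 : forall n, 'cV[R]_(d n))
    (beta0_cvg : sqnorm (beta0 n) / (d n)%:R @[n --> \oo] --> beta ^+ 2)
    (disp : nat -> measure_display) (T : forall n, measurableType (disp n))
    (P : forall n, probability (T n) R)
    (D : forall n, sample (P n) (N n) (d n))
    (D_law : forall n, sampled_from (D n) nu nu_noise sigma)
    (U : forall n, T n -> 'M[R]_(d n)) (ev : forall n, T n -> 'rV[R]_(d n))
    (U_diag : forall n w,
      orthogonal_diagonalization ((X_tr (D n) w)^T *m X_tr (D n) w)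
        (U n w) (ev n w)) :
  'E_(P n)[MSE (D n) (beta0 n)
    (fun w => biased_estimator p alpha (X_tr (D n) w) (Y_tr (D n) (beta0 n) w)
                (U n w) (ev n w))]%E @[n --> \oo]
    --> limit_err nu p lambda beta sigma alpha.
Proof.
case: nu_noise_supp => a [b [a_ge0 noise_supp]].
rewrite limit_err_mean//.
set A := mean_bias nu alpha p; set B := sigma ^+ 2 * mean_noise nu alpha p.
suff H n : 'E_(P n)[MSE (D n) (beta0 n)
    (fun w => biased_estimator p alpha (X_tr (D n) w) (Y_tr (D n) (beta0 n) w)
                (U n w) (ev n w))]%E =
    ((d n)%:R / (N n)%:R * (sqnorm (beta0 n) / (d n)%:R * A + B))%:E.
  under eq_fun do rewrite H.
  apply: cvg_EFin; first exact: nearW.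
  by apply: cvgM => //; apply: cvgD; [exact: cvgMl|exact: cvg_cst].
rewrite (expectation_MSE p (D_law n) nu_supp nu0 a_ge0 noise_supp nu_noise_mean
  alpha_ge0 (beta0 n) (U_diag n)).
congr EFin; rewrite -/A -/B.
(* For [d n = 0] the factor [d n] cannot be cancelled, but both sides are 0. *)
have [d0|d0] := eqVneq (d n) 0%N.
  have -> : sqnorm (beta0 n) = 0.
    by apply: big1 => i; have := ltn_ord i; rewrite [X in (_ < X)%N]d0.
  have -> : (d n)%:R = 0 :> R by rewrite d0.
  by rewrite !mul0r addr0 mulr0.
have dR0 : (d n)%:R != 0 :> R by rewrite pnatr_eq0.
(* With the inverse of [N n] abstracted, the identity requires only that [d n] be nonzero. *)
by move: ((N n)%:R^-1) => c; field.
Qed.
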